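(* For every $\mathsf{xSKSg}$ proof of size $n$ there exists an $\mathsf{sSKSg}$ proof of the same formula whose length and size are respectively $O(n)$ and $O(n^2)$.
   Context: CoS: formulae built from units $\mathsf f,\mathsf t$, atoms $a,\bar a,\dots$, formula variables $A,\bar A,\dots$ by $[\alpha\vee\beta]$ and $(\alpha\wedge\beta)$; $\bar\cdot$ involution on atoms and on variables with $\bar a\ne a$, $\bar A\ne A$; the De Morgan dual $\bar\alpha$ exchanges $\vee/\wedge$, $\mathsf t/\mathsf f$ and negates atoms and variables. Equality $=$ is the smallest context-closed equivalence containing commutativity and associativity of $\vee,\wedge$, $[\alpha\vee\mathsf f]=\alpha$, $(\alpha\wedge\mathsf t)=\alpha$, $[\mathsf t\vee\mathsf t]=\mathsf t$, $(\mathsf f\wedge\mathsf f)=\mathsf f$. A substitution $\sigma$ maps variables to formulae (applied simultaneously, $\bar A\mapsto$ dual of $\sigma(A)$); a renaming maps atoms to atoms. A rule $\alpha/\beta$ has instances $\alpha\rho\sigma/\beta\rho\sigma$ and generates steps $\xi\{\gamma\}/\xi\{\delta\}$ for any context (formula with one hole) $\xi$. A derivation in $\mathcal S$ from premiss $\alpha_0$ to conclusion $\alpha_k$ is a chain alternating $=$-steps and steps generated by rules of $\mathcal S$; its length is the number of steps and its size the number of occurrences of units, atoms and variables; a proof has premiss $\mathsf t$. $\mathsf{SKSg}$ has the rules $\mathsf t/[A\vee\bar A]$, $(A\wedge\bar A)/\mathsf f$, $\mathsf f/A$, $A/\mathsf t$, $[A\vee A]/A$, $A/(A\wedge A)$,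 $(A\wedge[B\vee C])/[(A\wedge B)\vee C]$. $\mathsf{xSKSg}$: an extended $\mathsf{SKSg}$ proof of $\alpha$ is an $\mathsf{SKSg}$ derivation with conclusion $\alpha$ and premiss $([\bar A_1\vee\beta_1]\wedge[\bar\beta_1\vee A_1]\wedge\dots\wedge[\bar A_h\vee\beta_h]\wedge[\bar\beta_h\vee A_h])$, where $A_1,\bar A_1,\dots,A_h,\bar A_h$ are mutually distinct variables and, for each $i$, neither $A_i$ nor $\bar A_i$ occurs in $\beta_1,\dots,\beta_i,\alpha$. $\mathsf{sSKSg}$: a proof of $\mathsf{SKSg}$ in which, in addition to steps generated by $\mathsf{SKSg}$ rules, one may use steps of the substitution rule, i.e. steps from a whole formula $\gamma$ (the entire current line, not inside a context) to $\gamma\sigma$ for a substitution $\sigma$. *)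

(* Defs.v *)
From HB Require Import structures.
From mathcomp Require Import all_boot.

Set Implicit Arguments.
Unset Strict Implicit.
Unset Printing Implicit Defensive.

(* Atoms and formula variables are two disjoint copies of a countably infinite
   set carrying a fixed-point-free involution: the literal [(n, true)] is the
   n-th positive one and [(n, false)] is its negation. *)
Definition literal : Type := (nat * bool)%type.
Definition bar (l : literal) : literal := (l.1, ~~ l.2).

Inductive formula : Type :=
| FF
| TT
| Atom of literal
| Var of literal
| Or of formula & formula
| And of formula & formula.

Fixpoint dual (a : formula) : formula :=
  match a with
  | FF => TT
  | TT => FF
  | Atom l => Atom (bar l)
  | Var X => Var (bar X)
  | Or a1 a2 => And (dual a1) (dual a2)
  | And a1 a2 => Or (dual a1) (dual a2)
  end.

Fixpoint fsize (a : formula) : nat :=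
  match a with
  | FF | TT | Atom _ | Var _ => 1
  | Or a1 a2 | And a1 a2 => fsize a1 + fsize a2
  end.

Fixpoint occurs (X : literal) (a : formula) : bool :=
  match a with
  | FF | TT | Atom _ => false
  | Var Y => X == Y :> nat * bool
  | Or a1 a2 | And a1 a2 => occurs X a1 || occurs X a2
  end.

Inductive context : Type :=
| Hole
| OrL of context & formula
| OrR of formula & context
| AndL of context & formula
| AndR of formula & context.

Fixpoint plug (xi : context) (a : formula) : formula :=
  match xi with
  | Hole => a
  | OrL xi1 b => Or (plug xi1 a) b
  | OrR b xi1 => Or b (plug xi1 a)
  | AndL xi1 b => And (plug xi1 a) b
  | AndR b xi1 => And b (plug xi1 a)
  end.

Inductive feq : formula -> formula -> Prop :=
| feq_orC a b : feq (Or a b) (Or b a)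
| feq_andC a b : feq (And a b) (And b a)
| feq_orA a b c : feq (Or (Or a b) c) (Or a (Or b c))
| feq_andA a b c : feq (And (And a b) c) (And a (And b c))
| feq_orF a : feq (Or a FF) a
| feq_andT a : feq (And a TT) a
| feq_orTT : feq (Or TT TT) TT
| feq_andFF : feq (And FF FF) FF
| feq_refl a : feq a a
| feq_sym a b : feq a b -> feq b a
| feq_trans a b c : feq a b -> feq b c -> feq a c
| feq_ctx xi a b : feq a b -> feq (plug xi a) (plug xi b).

(* Substitutions and renamings are given by their values on the positive
   literals; the value on a negative literal is the dual one. *)
Definition substitution : Type := nat -> formula.
Definition renaming : Type := nat -> literal.

Fixpoint subst (s : substitution) (a : formula) : formula :=
  match a with
  | FF => FF
  | TT => TT
  | Atom l => Atom l
  | Var X => if X.2 then s X.1 else dual (s X.1)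
  | Or a1 a2 => Or (subst s a1) (subst s a2)
  | And a1 a2 => And (subst s a1) (subst s a2)
  end.

Fixpoint rename (r : renaming) (a : formula) : formula :=
  match a with
  | FF => FF
  | TT => TT
  | Atom l => Atom (if l.2 then r l.1 else bar (r l.1))
  | Var X => Var X
  | Or a1 a2 => Or (rename r a1) (rename r a2)
  | And a1 a2 => And (rename r a1) (rename r a2)
  end.

(* [S a b] means that a / b is a rule of S. *)
Definition system : Type := formula -> formula -> Prop.

Inductive rule_step (S : system) : formula -> formula -> Prop :=
| Rule_step (xi : context) (r : renaming) (s : substitution) a b :
    S a b ->
    rule_step S (plug xi (subst s (rename r a))) (plug xi (subst s (rename r b))).

Inductive SKSg : system :=
| i_down : SKSg TT (Or (Var (0, true)) (Var (0, false)))
| i_up : SKSg (And (Var (0, true)) (Var (0, false))) FF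
| w_down : SKSg FF (Var (0, true))
| w_up : SKSg (Var (0, true)) TT
| c_down : SKSg (Or (Var (0, true)) (Var (0, true))) (Var (0, true))
| c_up : SKSg (Var (0, true)) (And (Var (0, true)) (Var (0, true)))
| switch :
    SKSg (And (Var (0, true)) (Or (Var (1, true)) (Var (2, true))))
         (Or (And (Var (0, true)) (Var (1, true))) (Var (2, true))).

(* The substitution rule rewrites the whole line, not a subformula of it. *)
Inductive sub_step : formula -> formula -> Prop :=
| Sub_step (s : substitution) a : sub_step a (subst s a).

(* The successive lines of a derivation: the premiss, then the result of each
   step. *)
Record chain : Type := Chain { premiss : formula; later_lines : seq formula }.

Definition conclusion (D : chain) : formula := last (premiss D) (later_lines D).

Definition dlength (D : chain) : nat := size (later_lines D).

Definition dsize (D : chain) : nat :=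
  sumn [seq fsize a | a <- premiss D :: later_lines D].

(* [alternating P Q a l]: from line [a], the steps leading through the lines
   [l] are in turn a P-step, a Q-step, a P-step, etc. *)
Fixpoint alternating (P Q : formula -> formula -> Prop)
    (a : formula) (l : seq formula) : Prop :=
  match l with
  | [::] => True
  | b :: l' => P a b /\ alternating Q P b l'
  end.

(* The first step may be of either kind, and so may the last. *)
Definition derivation (R : formula -> formula -> Prop) (D : chain) : Prop :=
  alternating feq R (premiss D) (later_lines D) \/
  alternating R feq (premiss D) (later_lines D).

(* Right-nested conjunction; the empty one is the unit t. *)
Fixpoint conj_of (l : seq formula) : formula :=
  match l with
  | [::] => TT
  | [:: a] => a
  | a :: l' => And a (conj_of l')
  end.

(* The extension variables and their definitions are indexed from 0; the values
   of A and b at indices i >= h are irrelevant. *)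
Definition ext_premiss (h : nat) (A : nat -> literal) (b : nat -> formula) :
    formula :=
  conj_of (flatten
    [seq [:: Or (Var (bar (A i))) (b i); Or (dual (b i)) (Var (A i))]
    | i <- iota 0 h]).

Definition fresh (X : literal) (a : formula) : bool :=
  ~~ occurs X a && ~~ occurs (bar X) a.

Definition xSKSg_proof (D : chain) (a : formula) : Prop :=
  exists (h : nat) (A : nat -> literal) (b : nat -> formula),
    [/\ derivation (rule_step SKSg) D,
        conclusion D = a,
        premiss D = ext_premiss h A b,
        uniq (flatten [seq ([:: A i; bar (A i)] : seq (nat * bool))
                      | i <- iota 0 h])
      & forall i, i < h ->
          fresh (A i) a /\ (forall j, j <= i -> fresh (A i) (b j))].

Definition sSKSg_proof (D : chain) (a : formula) : Prop :=
  [/\ derivation (fun c d => rule_step SKSg c d \/ sub_step c d) D,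
      conclusion D = a
    & premiss D = TT].

(* Main.v *)
(** Let P be the premiss of an extended proof of a.  From t one gets [~P \/ P]
    by an interaction, hence [~P \/ a] by running the extended proof inside the
    context [~P \/ {}].  Now ~P is a disjunction of the duals of the
    definitions of the extension variables.  The last variable A_h occurs
    neither in a nor in any definition but its own, so substituting b_h for it
    turns its dual definition into two copies of (b_h /\ ~b_h), which two cuts
    erase, and changes nothing else.  Repeating this for the earlier variables
    yields a in O(n) steps, all lines having size O(n). *)
Require Import Defs.
From mathcomp Require Import all_boot.
From mathcomp Require Import zify.

Set Implicit Arguments.
Unset Strict Implicit.
Unset Printing Implicit Defensive.

(** * Duality, substitution and freshness *)

Lemma barK : involutive bar.
Proof. by case=> k e; rewrite /bar /= negbK. Qed.

Lemma dualK : involutive dual.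
Proof. by elim=> //= [l|X|a -> b ->|a -> b ->] //; rewrite barK. Qed.

Lemma fsize_dual a : fsize (dual a) = fsize a.
Proof. by elim: a => //= a -> b ->. Qed.

Lemma fsize_Or a b : fsize (Or a b) = fsize a + fsize b.
Proof. by []. Qed.

Lemma fsize_gt0 a : 0 < fsize a.
Proof. by elim: a => //= a Ha b Hb; rewrite addn_gt0 Ha. Qed.

Lemma subst_dual s a : subst s (dual a) = dual (subst s a).
Proof.
elim: a => //= [[k []] /=|a -> b ->|a -> b ->] //.
by rewrite dualK.
Qed.

Lemma subst_id a : subst (fun k => Var (k, true)) a = a.
Proof. by elim: a => //= [[k []]|a -> b ->|a -> b ->]. Qed.

(** A substitution is given on positive literals only, so a negative [X] is sent to [b] by sending
    its positive partner to [dual b]. *)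
Definition subst1 (X : literal) (b : formula) : substitution :=
  fun k => if k == X.1 then if X.2 then b else dual b else Var (k, true).

Lemma subst1_var X b : subst (subst1 X b) (Var X) = b.
Proof. by rewrite /= /subst1 eqxx; case: X.2; rewrite ?dualK. Qed.

Lemma subst1_fresh X b a : fresh X a -> subst (subst1 X b) a = a.
Proof.
rewrite /fresh; elim: a => //= [[k e]|a IHa c IHc|a IHa c IHc].
- case: X => k' e'; rewrite /subst1 /bar -!pair_eqE /=.
  by rewrite [k' == k]eq_sym; case: (k == k') => //=; case: e e' => [] [].
- by rewrite !negb_or => /andP[/andP[? ?] /andP[? ?]]; rewrite IHa ?IHc //; apply/andP.
- by rewrite !negb_or => /andP[/andP[? ?] /andP[? ?]]; rewrite IHa ?IHc //; apply/andP.
Qed.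

Lemma fresh_dual X a : fresh X (dual a) = fresh X a.
Proof.
rewrite /fresh; elim: a => //= [[k e]|a IHa c IHc|a IHa c IHc].
- case: X => k' e'; rewrite /bar -!pair_eqE /=.
  by case: (k' == k) e e' => [] [] [].
- by rewrite !negb_or andbACA IHa IHc andbACA.
- by rewrite !negb_or andbACA IHa IHc andbACA.
Qed.

Lemma fresh_Or X a b : fresh X (Or a b) = fresh X a && fresh X b.
Proof. by rewrite /fresh /= !negb_or andbACA. Qed.

Lemma fresh_And X a b : fresh X (And a b) = fresh X a && fresh X b.
Proof. by rewrite /fresh /= !negb_or andbACA. Qed.

Lemma conj_of_cons a b l : conj_of (a :: b :: l) = And a (conj_of (b :: l)).
Proof. by []. Qed.

Lemma fresh_conj_of X l : all (fresh X) l -> fresh X (conj_of l).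
Proof.
elim: l => [//|a [|b l] IH]; first by rewrite /= andbT.
by rewrite conj_of_cons fresh_And => /andP[-> /IH].
Qed.

Lemma fsize_conj_of l : 0 < size l -> fsize (conj_of l) = sumn (map fsize l).
Proof.
elim: l => [//|a [|b l] IH] _; first by rewrite /= addn0.
by rewrite conj_of_cons [LHS]/= IH.
Qed.

(** * Equality and rule steps inside disjunctions *)

Lemma feq_orL a a' b : feq a a' -> feq (Or a b) (Or a' b).
Proof. exact: (feq_ctx (OrL Hole b)). Qed.

Lemma feq_orR a b b' : feq b b' -> feq (Or a b) (Or a b').
Proof. exact: (feq_ctx (OrR a Hole)). Qed.

Lemma feq_For a : feq a (Or FF a).
Proof. exact: feq_trans (feq_sym (feq_orF a)) (feq_orC _ _). Qed.

(** This holds only up to [feq]: for empty [l] the right-hand side carries an extra unit [FF]. *)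
Lemma feq_dual_conj_of_cons a l :
  feq (dual (conj_of (a :: l))) (Or (dual a) (dual (conj_of l))).
Proof. case: l => [|b l] /=; [exact/feq_sym/feq_orF | exact: feq_refl]. Qed.

Lemma feq_dual_conj_of_cat l1 l2 :
  feq (dual (conj_of (l1 ++ l2))) (Or (dual (conj_of l1)) (dual (conj_of l2))).
Proof.
elim: l1 => [|a l1 IH]; first exact: feq_For.
apply: feq_trans (feq_dual_conj_of_cons _ _) _.
apply: feq_trans (feq_orR _ IH) _.
apply: feq_trans (feq_sym (feq_orA _ _ _)) _.
exact/feq_orL/feq_sym/feq_dual_conj_of_cons.
Qed.

Lemma rule_step_i_down a : rule_step SKSg TT (Or a (dual a)).
Proof.
exact: (Rule_step Hole (fun k => (k, true)) (fun=> a) i_down).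
Qed.

Lemma rule_step_i_up xi a : rule_step SKSg (plug xi (And a (dual a))) (plug xi FF).
Proof. exact: (Rule_step xi (fun k => (k, true)) (fun=> a) i_up). Qed.

Lemma rule_step_orR S a b b' :
  rule_step S b b' -> rule_step S (Or a b) (Or a b').
Proof.
case=> xi r s c d Scd; exact: (Rule_step (OrR a xi) r s Scd).
Qed.

(** * Step sequences with a bound on every line *)

Definition sSKSg_step (a b : formula) : Prop :=
  rule_step SKSg a b \/ sub_step a b.

(** Without the alternation condition, pieces concatenate freely. Since each line has size at most
    [M], [k] steps have total size at most [k.+1 * M]. *)
Inductive steps (M : nat) : nat -> formula -> formula -> Prop :=
| steps0 a : fsize a <= M -> steps M 0 a a
| stepsS k a b c : fsize a <= M -> feq a b \/ sSKSg_step a b ->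
    steps M k b c -> steps M k.+1 a c.

Lemma steps_trans M k k' a b c :
  steps M k a b -> steps M k' b c -> steps M (k + k') a c.
Proof.
elim=> [//|{}k x y z sx xy _ IH] /IH; exact: stepsS.
Qed.

(* Identity steps of either kind are available, so strict alternation only
   doubles the length. *)
Lemma steps_alternating M k a b : steps M k a b ->
  exists l, [/\ alternating feq sSKSg_step a l, last a l = b,
    size l = k.*2 & all (fun x => fsize x <= M) (a :: l)].
Proof.
elim=> [x sx|{}k x y z sx xy _ [l [alt_l last_l sz_l all_l]]].
  by exists [::]; split=> //=; rewrite sx.
case: xy => xy.
- exists [:: y, y & l]; split=> //=; last by move: all_l; rewrite /= sx => /andP[-> ->].
  + split=> //; split=> //; right.
    by rewrite -{2}[y]subst_id; exact: Sub_step.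
  + by rewrite sz_l.
- exists [:: x, y & l]; split=> //=; last by move: all_l; rewrite /= sx.
  + by split=> //; exact: feq_refl.
  + by rewrite sz_l.
Qed.

(** Equality and [SKSg] steps are closed under contexts. Substitution steps are not, but an extended
    proof contains none. *)
Lemma steps_context c M a l :
    alternating feq (rule_step SKSg) a l \/ alternating (rule_step SKSg) feq a l ->
    all (fun x => fsize c + fsize x <= M) (a :: l) ->
  steps M (size l) (Or c a) (Or c (last a l)).
Proof.
elim: l a => [|b l IH] a alt /= /andP[sa sl]; first exact: steps0.
apply: (@stepsS _ _ _ (Or c b)) => //; last by apply: IH sl; case: alt => -[_]; [right|left].
case: alt => -[ab _]; first by left; apply: feq_orR.
by right; left; apply: rule_step_orR.
Qed.

Lemma all_le_sumn (T : Type) (f : T -> nat) (s : seq T) :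
  all (fun x => f x <= sumn (map f s)) s.
Proof.
elim: s => //= x s IH; rewrite leq_addr /=.
by apply: sub_all IH => y /leq_trans-> //; rewrite leq_addl.
Qed.

Lemma sumn_le_size (T : Type) (f : T -> nat) M (s : seq T) :
  all (fun x => f x <= M) s -> sumn (map f s) <= size s * M.
Proof. by elim: s => //= x s IH /andP[fx /IH]; rewrite mulSn; apply: leq_add. Qed.

Lemma size_le_sumn (T : Type) (f : T -> nat) (s : seq T) :
  (forall x, 0 < f x) -> size s <= sumn (map f s).
Proof. by move=> f_gt0; elim: s => //= x s IH; rewrite -add1n leq_add. Qed.

(** * The premiss of an extended proof and its elimination *)

Definition ext_def (A : nat -> literal) (b : nat -> formula) (i : nat) :
    seq formula :=
  [:: Or (Var (bar (A i))) (b i); Or (dual (b i)) (Var (A i))].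

Lemma ext_premissS A b j :
  ext_premiss j.+1 A b =
  conj_of (flatten [seq ext_def A b i | i <- iota 0 j] ++ ext_def A b j).
Proof.
by rewrite /ext_premiss -addn1 iotaD map_cat flatten_cat /= add0n.
Qed.

(** The two variable occurrences of the new definition are not counted: when [j] is 0, one of them
    makes up for the unit [TT], which disappears. *)
Lemma fsize_ext_premissS A b j :
  fsize (ext_premiss j A b) + (fsize (b j)).*2 <= fsize (ext_premiss j.+1 A b).
Proof.
rewrite ext_premissS fsize_conj_of; last by rewrite size_cat addn_gt0 orbT.
rewrite map_cat sumn_cat /= fsize_dual /ext_premiss -/(ext_def A b).
case: (flatten _) => [|x l]; first by rewrite /=; lia.
by rewrite fsize_conj_of //; lia.
Qed.

(** Each definition adds at least 2 to the size. With [j] equal to 0 this bounds the number of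
    definitions linearly. *)
Lemma fsize_ext_premiss_ge A b j h : j <= h ->
  fsize (ext_premiss j A b) + (h - j).*2 <= fsize (ext_premiss h A b).
Proof.
elim: h => [|h IH]; first by rewrite leqn0 => /eqP->; rewrite addn0.
rewrite leq_eqVlt => /predU1P[->|jh]; first by rewrite subnn addn0.
have := fsize_ext_premissS A b h; have := fsize_gt0 (b h); have := IH jh; lia.
Qed.

Lemma distinct_extension (A : nat -> literal) h i j :
    uniq (flatten [seq ([:: A i; bar (A i)] : seq (nat * bool)) | i <- iota 0 h]) ->
    i < j -> j < h ->
  fresh (A j) (Var (A i)).
Proof.
move=> + ij jh.
(* Cutting the index list just before [j] puts [A i] in the first part and [A j] at the head of the
   second; uniqueness makes the parts disjoint. *)
have -> : h = j + (h - j.+1).+1 by lia.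
rewrite iotaD map_cat flatten_cat cat_uniq => /and3P[_ /hasPn dis _].
have in1 : (A i : nat * bool) \in
  flatten [seq ([:: A i; bar (A i)] : seq (nat * bool)) | i <- iota 0 j].
  apply/flatten_mapP; exists i; first by rewrite mem_iota.
  by rewrite inE eqxx.
apply/andP; split; apply: contraTN in1 => /= /eqP <-; apply: dis => /=;
  by rewrite !inE add0n eqxx ?orbT.
Qed.

Lemma fresh_ext_premiss A b h j :
    uniq (flatten [seq ([:: A i; bar (A i)] : seq (nat * bool)) | i <- iota 0 h]) ->
    j < h -> (forall i, i <= j -> fresh (A j) (b i)) ->
  fresh (A j) (ext_premiss j A b).
Proof.
move=> uA jh frb; apply: fresh_conj_of.
(* Only the bound on the indices matters, so the induction runs over an arbitrary list of indices
   below [j]. *)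
have : {subset iota 0 j <= [pred i | i < j]} by move=> i; rewrite mem_iota.
elim: iota => //= i s IH sub_s.
have ij : i < j by apply: sub_s; rewrite mem_head.
rewrite IH => [|k ks]; last by apply: sub_s; rewrite inE ks orbT.
rewrite !fresh_Or -[Var (bar _)]/(dual (Var (A i))) !fresh_dual.
by rewrite (distinct_extension uA ij jh) !frb // ltnW.
Qed.

(** The five steps are a regrouping, the substitution, two cuts and the removal of units. *)
Lemma eliminate_definition A b j a M :
    fresh (A j) (ext_premiss j A b) -> fresh (A j) (b j) -> fresh (A j) a ->
    (fsize (ext_premiss j.+1 A b)).*2 + fsize a <= M ->
  steps M 5 (Or (dual (ext_premiss j.+1 A b)) a) (Or (dual (ext_premiss j A b)) a).
Proof.
move=> frP frb fra sM.
have := fsize_ext_premissS A b j; have := fsize_gt0 (b j) => b_gt0 szP.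
set N := dual (ext_premiss j A b).
pose cut := And (b j) (dual (b j)).
have dual_def : dual (conj_of (ext_def A b j)) =
    Or (And (Var (A j)) (dual (b j))) (And (b j) (dual (Var (A j)))).
  by rewrite /= barK dualK.
have szN : fsize N = fsize (ext_premiss j A b) by rewrite fsize_dual.
have szb : fsize (dual (b j)) = fsize (b j) by rewrite fsize_dual.
apply: (@stepsS _ _ _ (Or (Or N (dual (conj_of (ext_def A b j)))) a)).
- by rewrite fsize_Or fsize_dual; lia.
- by left; apply: feq_orL; rewrite ext_premissS; apply: feq_dual_conj_of_cat.
apply: (@stepsS _ _ _ (Or (Or N (Or cut cut)) a)).
- by rewrite dual_def /=; lia.
- right; right.
  suff <- : subst (subst1 (A j) (b j))
      (Or (Or N (dual (conj_of (ext_def A b j)))) a) = Or (Or N (Or cut cut)) a.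
    exact: Sub_step.
  rewrite dual_def.
  (* Simplification would also unfold the substitution at [Var (A j)] and block [subst1_var], hence
     these explicit rewrite rules. *)
  have substE c d : subst (subst1 (A j) (b j)) (Or c d) =
    Or (subst (subst1 (A j) (b j)) c) (subst (subst1 (A j) (b j)) d) by [].
  have substE' c d : subst (subst1 (A j) (b j)) (And c d) =
    And (subst (subst1 (A j) (b j)) c) (subst (subst1 (A j) (b j)) d) by [].
  by rewrite !(substE, substE') !subst_dual subst1_var !subst1_fresh.
apply: (@stepsS _ _ _ (Or (Or N (Or FF cut)) a)).
(* This is the line that motivates the doubling in the bound: it holds four copies of [b j] up to
   duality, while the premiss accounts for two. *)
- by rewrite /=; lia.
- by right; left; apply: (rule_step_i_up (OrL (OrR N (OrL Hole cut)) a)).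
apply: (@stepsS _ _ _ (Or (Or N (Or FF FF)) a)).
- by rewrite /=; lia.
- by right; left; apply: (rule_step_i_up (OrL (OrR N (OrR FF Hole)) a)).
apply: (@stepsS _ _ _ (Or N a)).
- by rewrite /=; lia.
- left; apply: feq_orL; apply: feq_trans (feq_orF _).
  exact/feq_orR/feq_orF.
by apply: steps0; rewrite /=; lia.
Qed.

Theorem theorem5p11 :
  exists c : nat, forall (n : nat) (a : formula) (D : chain),
    xSKSg_proof D a -> dsize D = n ->
    exists E : chain,
      [/\ sSKSg_proof E a, dlength E <= c * n & dsize E <= c * n ^ 2].
Proof.
(* A generous constant: the length will be at most [7 * n + 4], and each line has size at most
   [3 * n]. *)
exists 100 => n a [p l] [h [A [b []]]].
rewrite /derivation /conclusion /dlength /dsize.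
rewrite [premiss _]/= [later_lines _]/= => derD lastD def_p uA frA szD.
pose P j := ext_premiss j A b.
have all_n : all (fun x => fsize x <= n) (p :: l) by rewrite -szD all_le_sumn.
have p_n : fsize (P h) <= n by move: all_n; rewrite def_p => /andP[].
have a_n : fsize a <= n.
  by move: all_n; rewrite lastI lastD all_rcons => /andP[].
have l_n : (size l).+1 <= n.
  by rewrite -szD; apply: (size_le_sumn (p :: l) fsize_gt0).
(* The bound [3 * n] allows twice the size of the premiss plus that of [a], each at most [n]. *)
have steps_elim j : j <= h ->
    steps (3 * n) (5 * j) (Or (dual (P j)) a) (Or (dual (P 0)) a).
  elim: j => [|j IH] jh.
    apply: steps0; rewrite fsize_Or fsize_dual.
    by have := fsize_ext_premiss_ge A b jh; rewrite -/(P _) -/(P _); lia.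
  rewrite mulnS; apply: steps_trans (IH (ltnW jh)).
  have [fra frb] := frA j jh.
  apply: eliminate_definition; rewrite ?frb //.
    exact: fresh_ext_premiss uA jh frb.
  by have := fsize_ext_premiss_ge A b jh; rewrite -/(P _) -/(P _); lia.
have steps_ext : steps (3 * n) (size l) (Or (dual (P h)) (P h)) (Or (dual (P h)) a).
  rewrite -lastD /P -def_p; apply: steps_context => //.
  by apply: sub_all all_n => x; rewrite def_p fsize_dual -/(P h); lia.
have steps_all : steps (3 * n) (size l + (5 * h + 1)).+2 TT a.
  apply: (@stepsS _ _ _ (Or (P h) (dual (P h)))).
  - by rewrite /=; lia.
  - by right; left; apply: rule_step_i_down.
  apply: (@stepsS _ _ _ (Or (dual (P h)) (P h))).
  - by rewrite /= fsize_dual; lia.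
  - by left; apply: feq_orC.
  apply: (steps_trans steps_ext); apply: steps_trans (steps_elim h (leqnn h)) _.
  (* With all definitions gone, [dual (P 0)] is the unit [FF]. *)
  apply: (@stepsS _ _ _ a); last by apply: steps0; lia.
  - by rewrite /=; lia.
  - by left; apply/feq_sym/feq_For.
have [L [altL lastL szL all_L]] := steps_alternating steps_all.
have h_n : h.*2 <= n.
  by have := fsize_ext_premiss_ge A b (leq0n h); rewrite -/(P _) -/(P _); lia.
exists (Chain TT L); split.
- by split=> //; left.
- by rewrite /dlength /= szL; lia.
rewrite /dsize; apply: leq_trans (sumn_le_size all_L) _.
by rewrite /= szL; nia.
Qed.
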